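(* Let $p$ be an odd prime, let $q\in\mathbb{C}_p$ with $|1-q|_p<p^{-\frac{1}{p-1}}$, and let $x\in\mathbb{Z}_p$. For every integer $n\ge0$, \[ q\,Ch_{n,q}(x+1)+Ch_{n,q}(x)=[2]_q\sum_{l=0}^nS_1(n,l)[x]_q^l. \]
   Context: For $x\in\mathbb{Z}_p$, $[x]_q=\frac{q^x-1}{q-1}$; $[2]_q=1+q$. The fermionic $p$-adic $q$-integral of a continuous $f:\mathbb{Z}_p\to\mathbb{C}_p$ is $\int_{\mathbb{Z}_p}f(y)\,d\mu_{-q}(y)=\lim_{N\to\infty}\frac{1}{[p^N]_{-q}}\sum_{y=0}^{p^N-1}f(y)(-q)^y$, where $[m]_{-q}=\frac{1-(-q)^m}{1+q}$. The Carlitz-type $q$-Changhee polynomials $Ch_{n,q}(x)$ are defined by $\int_{\mathbb{Z}_p}(1+t)^{[x+y]_q}\,d\mu_{-q}(y)=\sum_{n\ge0}Ch_{n,q}(x)\frac{t^n}{n!}$ for $t\in\mathbb{C}_p$ with $|t|_p<p^{-\frac{1}{p-1}}$. $S_1(n,k)$ are the (signed) Stirling numbers of the first kind, $x(x-1)\cdots(x-n+1)=\sum_{k=0}^nS_1(n,k)x^k$. *)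

(* Defs.v *)
From HB Require Import structures.
From mathcomp Require Import all_boot all_order all_algebra.
From mathcomp Require Import all_classical all_reals all_analysis.

Set Implicit Arguments.
Unset Strict Implicit.
Unset Printing Implicit Defensive.

Import Order.TTheory GRing.Theory Num.Theory.
Import numFieldNormedType.Exports.

Local Open Scope classical_set_scope.
Local Open Scope ring_scope.

Section Valued.
Context (R : realType) (K : fieldType) (abs : K -> R).

Definition cvgK (u : nat -> K) (l : K) : Prop :=
  (fun n => abs (u n - l)) @ \oo --> (0 : R).

Definition cauchyK (u : nat -> K) : Prop :=
  forall e : R, 0 < e ->
    exists N : nat, forall m n : nat,
      (N <= m)%N -> (N <= n)%N -> abs (u m - u n) < e.

(* Total operator: the value is 0 when u does not converge. *)
Definition limK (u : nat -> K) : K := xget 0 [set l | cvgK u l].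

Definition partial_sum (u : nat -> K) : nat -> K :=
  fun N => \sum_(n < N) u n.

Definition sumK (u : nat -> K) : K := limK (partial_sum u).

(* When K is C_p, this is the closure of Q in K, i.e. the copy of Q_p. *)
Definition padicQ : set K :=
  [set a | exists u : nat -> rat, cvgK (fun n => ratr (u n)) a].

Definition padicZ : set K := [set a | padicQ a /\ abs a <= 1].

Definition algebraic_over_Qp (a : K) : Prop :=
  exists P : {poly K}, [/\ P != 0, forall i : nat, padicQ P`_i & root P a].

End Valued.

(* (K, abs) is C_p, the completion of an algebraic closure of Q_p, with
   abs normalized by |p| = 1/p.  These properties determine (K, abs) up to
   isometric isomorphism: by completeness padicQ abs is the completion of Q for
   the p-adic absolute value, its algebraic closure in K is dense in K, and
   K is complete. *)
Record is_Cp (p : nat) (R : realType) (K : closedFieldType) (abs : K -> R)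
    : Prop := IsCp {
  Cp_abs_ge0 : forall a : K, 0 <= abs a;
  Cp_abs_eq0 : forall a : K, abs a = 0 <-> a = 0;
  Cp_absM : forall a b : K, abs (a * b) = abs a * abs b;
  Cp_absD : forall a b : K, abs (a + b) <= Num.max (abs a) (abs b);
  Cp_abs_p : abs p%:R = p%:R^-1;
  Cp_complete : forall u : nat -> K,
    cauchyK abs u -> exists l : K, cvgK abs u l;
  Cp_dense : forall (a : K) (e : R), 0 < e ->
    exists b : K, algebraic_over_Qp abs b /\ abs (a - b) < e
}.

(* p^(-1/(p-1)), the radius of convergence of the p-adic exponential. *)
Definition exp_radius (R : realType) (p : nat) : R :=
  p%:R `^ (- (p%:R - 1)^-1).

Section Changhee.
Context (R : realType) (K : fieldType) (abs : K -> R).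

Definition pexp (z : K) : K := sumK abs (fun n => z ^+ n / n`!%:R).

Definition plog (a : K) : K :=
  sumK abs (fun n => (-1) ^+ n * (a - 1) ^+ n.+1 / n.+1%:R).

(* a^z := exp (z log a), used for |a - 1| < p^(-1/(p-1)) and |z| <= 1. *)
Definition ppow (a z : K) : K := pexp (z * plog a).

(* At q = 1 the quotient is read as its limit x. *)
Definition qnum (q x : K) : K :=
  if q == 1 then x else (ppow q x - 1) / (q - 1).

(* [m]_{-q} *)
Definition qnum_neg (q : K) (m : nat) : K := (1 - (- q) ^+ m) / (1 + q).

(* The integrand f : Z_p -> C_p is represented by a function on all of K; only
   its values at natural numbers are used. *)
Definition fermionic_integral (p : nat) (q : K) (f : K -> K) : K :=
  limK abs (fun N : nat =>
    (qnum_neg q (p ^ N)%N)^-1 * \sum_(y < p ^ N) f y%:R * (- q) ^+ y).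

Definition Changhee_egf (p : nat) (q x : K) (c : nat -> K) : Prop :=
  forall t : K, abs t < exp_radius R p ->
    cvgK abs (partial_sum (fun n => c n * (t ^+ n / n`!%:R)))
      (fermionic_integral p q (fun y => ppow (1 + t) (qnum q (x + y)))).

(* The (unique) sequence n |-> Ch_{n,q}(x) with the above exponential generating
   function; the zero sequence would be returned if there were none. *)
Definition Changhee (p : nat) (q : K) (n : nat) (x : K) : K :=
  xget (fun _ : nat => 0 : K) [set c | Changhee_egf p q x c] n.

End Changhee.

(* S_1(n,k): coefficient of X^k in X (X - 1) ... (X - n + 1). *)
Definition stirling1 (n k : nat) : int :=
  (\prod_(i < n) ('X - (i%:R)%:P) : {poly int})`_k.

(* Main.v *)
(** The average of f(y) weighted by (-q)^y is a functional of norm at most 1, and on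
functions f that are 1-Lipschitz on the naturals its N-th average is within
p^-N of the limit; telescoping the averages gives
q I(f(. + 1)) + I(f) = (1 + q) f(0).  This is applied to
f(y) = (1+t)^[x+y]_q, which is 1-Lipschitz because ppow (1 + t) z is the
binomial series with n-th term ffactr z n / n! t^n: the falling factorials are
integer polynomials, and |t^n / n!| <= (|t| / r)^n with r = p^(-1/(p-1)) by
Legendre's formula.  The binomial series comes from rearranging
exp (z log (1 + t)), using that the generating series of stirling1 n k / n! is
log(1+t)^k / k!.  Integrating it term by term shows that the egf of the
Changhee polynomials exists, and comparing the coefficients of t^n, which are
determined by the values at t = p^j, gives the theorem. *)

Require Import Defs.
From HB Require Import structures.
From mathcomp Require Import all_boot all_order all_algebra.
From mathcomp Require Import all_classical all_reals all_analysis.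
From mathcomp Require Import ring zify.

Set Implicit Arguments.
Unset Strict Implicit.
Unset Printing Implicit Defensive.

Import Order.TTheory GRing.Theory Num.Theory.
Import numFieldNormedType.Exports.

Local Open Scope ring_scope.

(** * Stirling numbers of the first kind *)

Lemma stirling1_0n k : stirling1 0 k = (k == 0%N)%:Z.
Proof. by rewrite /stirling1 big_ord0 coef1; case: eqP. Qed.

Lemma stirling1_S0 n : stirling1 n.+1 0 = - (n%:Z * stirling1 n 0).
Proof.
by rewrite /stirling1 big_ord_recr /= mulrBr coefB coefMX coefMC sub0r mulrC natz.
Qed.

Lemma stirling1_SS n k :
  stirling1 n.+1 k.+1 = stirling1 n k - n%:Z * stirling1 n k.+1.
Proof.
by rewrite /stirling1 big_ord_recr /= mulrBr coefB coefMX coefMC [_ * n%:R]mulrC natz.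
Qed.

Lemma stirling1_gt n k : (n < k)%N -> stirling1 n k = 0.
Proof.
elim: n k => [|n IH] [|k]; rewrite ?stirling1_0n// stirling1_SS ltnS => nk.
by rewrite !IH ?mulr0 ?subr0// ltnW.
Qed.

Lemma stirling1_Sn0 n : stirling1 n.+1 0 = 0.
Proof. by elim: n => [|n IH]; rewrite stirling1_S0 ?IH ?mulr0 ?oppr0// mul0r. Qed.

Lemma stirling1_Sn1 n : stirling1 n.+1 1 = (-1) ^+ n * n`!%:Z.
Proof.
elim: n => [|n IH]; first by rewrite stirling1_SS !stirling1_0n.
by rewrite stirling1_SS stirling1_Sn0 IH factS PoszM exprS; ring.
Qed.

(** * Falling factorials and the coefficients of powers of the logarithm *)

Section FallingFactorial.
Context (K : fieldType).
Implicit Types z : K.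

Definition ffactr z n : K := \prod_(i < n) (z - i%:R).

Lemma ffactrS z n : ffactr z n.+1 = ffactr z n * (z - n%:R).
Proof. exact: big_ord_recr. Qed.

Lemma ffactr_stirling1 z n :
  ffactr z n = \sum_(k < n.+1) (stirling1 n k)%:~R * z ^+ k.
Proof.
elim: n => [|n IH].
  by rewrite /ffactr big_ord0 big_ord1 stirling1_0n mulr1.
rewrite ffactrS big_ord_recl stirling1_Sn0 mul0r add0r mulrBr.
under [RHS]eq_bigr => k _ do
  rewrite lift0 stirling1_SS rmorphB rmorphM /= mulrBl.
rewrite sumrB; congr (_ - _).
  by rewrite IH mulr_suml; apply: eq_bigr => k _; rewrite exprSr mulrA.
rewrite big_ord_recr /= stirling1_gt// mulr0 mul0r addr0 mulrC {1}IH mulr_sumr.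
rewrite big_ord_recl; case: n {IH} => [|n]; first by rewrite !mul0r add0r !big_ord0.
rewrite stirling1_Sn0 mul0r mulr0 add0r; apply: eq_bigr => k _.
by rewrite lift0 mulrA.
Qed.

Context (natr_neq0 : forall n, n.+1%:R != 0 :> K).

Lemma factr_neq0 n : n`!%:R != 0 :> K.
Proof. by rewrite -(prednK (fact_gt0 n)). Qed.

(** The coefficient of [t^n] in [log(1+t)^k / k!]. *)
Definition stirf n k : K := (stirling1 n k)%:~R / n`!%:R.

Lemma stirf_gt n k : (n < k)%N -> stirf n k = 0.
Proof. by move=> nk; rewrite /stirf stirling1_gt// mul0r. Qed.

Lemma stirf_n0 n : stirf n 0 = (n == 0%N)%:R.
Proof. by case: n => [|n]; rewrite /stirf ?stirling1_Sn0 ?mul0r// stirling1_0n divr1. Qed.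

(** Coefficientwise form of [(1+t) d/dt (L^(k+1)/(k+1)!) = L^k/k!] with [L = log(1+t)]. *)
Lemma stirf_SS n k :
  n.+1%:R * stirf n.+1 k.+1 = stirf n k - n%:R * stirf n k.+1.
Proof.
rewrite /stirf stirling1_SS factS natrM rmorphB rmorphM /=.
field.
by rewrite factr_neq0 ?natr1 ?nat1r natr_neq0.
Qed.

Lemma stirf_S1 n : n.+1%:R * stirf n.+1 1 = (n == 0%N)%:R - n%:R * stirf n 1.
Proof. by rewrite stirf_SS stirf_n0. Qed.

Lemma stirf_Sn1 n : stirf n.+1 1 = (-1) ^+ n / n.+1%:R.
Proof.
rewrite /stirf stirling1_Sn1 factS natrM rmorphM /= rmorphXn rmorphN1.
field.
by rewrite factr_neq0 ?natr1 ?nat1r natr_neq0.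
Qed.

(* Coefficients of log(1+t) log(1+t)^k/k! = (k+1) log(1+t)^(k+1)/(k+1)!; both
   sides satisfy the recurrence obtained by applying (1+t) d/dt. *)
Lemma stirf_conv n k :
  \sum_(i < n.+1) stirf i 1 * stirf (n - i) k = k.+1%:R * stirf n k.+1.
Proof.
elim: n k => [|n IH] k.
  by rewrite big_ord1 (stirf_gt (ltn0Sn 0)) (stirf_gt (ltn0Sn k)) mul0r mulr0.
apply: (mulfI (natr_neq0 n)); rewrite mulrCA stirf_SS.
(* Leibniz rule: the weight [n+1] splits as [i + (n+1-i)], and [T] collects the part where the
   derivative hits the second factor. *)
pose T := \sum_(i < n.+1) stirf i 1 * ((n - i).+1%:R * stirf (n - i).+1 k).
have -> : n.+1%:R * \sum_(i < n.+2) stirf i 1 * stirf (n.+1 - i) k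
    = \sum_(i < n.+1) (i.+1%:R * stirf i.+1 1) * stirf (n - i) k + T.
  have -> : \sum_(i < n.+1) (i.+1%:R * stirf i.+1 1) * stirf (n - i) k
      = \sum_(i < n.+2) (i%:R * stirf i 1) * stirf (n.+1 - i) k.
    rewrite [RHS]big_ord_recl !mul0r add0r; apply: eq_bigr => i _.
    by rewrite lift0 subSS.
  have -> : T = \sum_(i < n.+2) stirf i 1 * ((n.+1 - i)%:R * stirf (n.+1 - i) k).
    rewrite [RHS]big_ord_recr /= subnn !mul0r mulr0 addr0; apply: eq_bigr => i _.
    by rewrite subSn ?leq_ord.
  rewrite -big_split mulr_sumr; apply: eq_bigr => i _ /=.
  by rewrite natrB ?leq_ord//; ring.
have -> : \sum_(i < n.+1) (i.+1%:R * stirf i.+1 1) * stirf (n - i) k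
    = stirf n k - \sum_(i < n.+1) i%:R * (stirf i 1 * stirf (n - i) k).
  under eq_bigr => i _ do rewrite stirf_S1 mulrBl -mulrA.
  rewrite sumrB; congr (_ - _).
  by rewrite big_ord_recl mul1r subn0 big1 ?addr0// => i _; rewrite mul0r.
have TE : T = k%:R * stirf n k
    - \sum_(i < n.+1) (n - i)%:R * (stirf i 1 * stirf (n - i) k).
  rewrite {}/T; case: k => [|k].
    rewrite mul0r sub0r -sumrN; apply: eq_bigr => i _; rewrite !stirf_n0.
    by case: (n - i)%N => [|m]; rewrite ?mulr0 ?oppr0// mul0r oppr0.
  rewrite -IH -sumrB; apply: eq_bigr => i _; rewrite stirf_SS; ring.
rewrite TE; have -> : k.+1%:R * (stirf n k - n%:R * stirf n k.+1)
  = stirf n k + k%:R * stirf n k - n%:R * (k.+1%:R * stirf n k.+1).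
  by rewrite -(natr1 k); ring.
rewrite -(IH k) mulr_sumr addrACA -opprD -big_split; congr (_ - _).
by apply: eq_bigr => i _ /=; rewrite natrB ?leq_ord//; ring.
Qed.

End FallingFactorial.

(** * Series in a complete ultrametric field *)

Section GeometricBounds.
Context (R : realType).

Lemma expr_lt_eventually (C rho e : R) : 0 <= rho < 1 -> 0 < e ->
  exists N, forall n, (N <= n)%N -> C * rho ^+ n < e.
Proof.
move=> /andP[rho0 rho1] e0.
have : (C * rho ^+ n @[n --> \oo] --> (C * 0 : R))%classic.
  by apply: cvgMr; apply: cvg_expr; rewrite ger0_norm.
rewrite mulr0 => /cvgr0Pnorm_lt/(_ _ e0)[N _ NP]; exists N => n Nn.
exact: le_lt_trans (ler_norm _) (NP n Nn).
Qed.

(** Letting [n] grow gives [z <= max(e, 0)]; the second alternative covers a negative [e]. *)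
Lemma le_max_expr (C rho e z : R) : 0 <= rho < 1 ->
  (forall n, z <= Num.max e (C * rho ^+ n)) -> z <= e \/ z <= 0.
Proof.
move=> rho01 zP; have [ze|ez] := leP z e; [by left|right].
have [//|z0] := leP z 0.
have [N /(_ N (leqnn _))] := expr_lt_eventually C rho01 z0.
by have := zP N; rewrite le_max leNgt ez /= leNgt => /negPf ->.
Qed.

End GeometricBounds.

Section Ultrametric.
Context (R : realType) (K : fieldType) (abs : K -> R).
Context (abs_ge0 : forall a, 0 <= abs a).
Context (abs_eq0 : forall a, abs a = 0 <-> a = 0).
Context (absM : forall a b, abs (a * b) = abs a * abs b).
Context (absD : forall a b, abs (a + b) <= Num.max (abs a) (abs b)).
Context (abs_complete : forall u, cauchyK abs u -> exists l, cvgK abs u l).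
Implicit Types (a b : K) (e rho C : R) (u v : nat -> K).

Lemma abs0 : abs 0 = 0. Proof. exact/abs_eq0. Qed.

Lemma abs_neq0 a : a != 0 -> abs a != 0.
Proof. by apply: contra => /eqP/abs_eq0/eqP. Qed.

Lemma abs_gt0 a : a != 0 -> 0 < abs a.
Proof. by move=> a0; rewrite lt_def abs_ge0 abs_neq0. Qed.

Lemma abs1 : abs 1 = 1.
Proof.
by apply: (mulfI (abs_neq0 (oner_neq0 K))); rewrite -absM !mulr1.
Qed.

Lemma absN a : abs (- a) = abs a.
Proof.
have N1 : abs (-1) = 1.
  apply/eqP; rewrite -(eqrXn2 (n := 2)) ?abs_ge0 ?ler01//.
  by rewrite expr1n expr2 -absM mulrNN mulr1 abs1.
by rewrite -mulN1r absM N1 mul1r.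
Qed.

Lemma absB a b : abs (a - b) = abs (b - a).
Proof. by rewrite -absN opprB. Qed.

Lemma absX a n : abs (a ^+ n) = abs a ^+ n.
Proof. by elim: n => [|n IH]; rewrite ?expr0 ?abs1// !exprS absM IH. Qed.

Lemma absV a : abs a^-1 = (abs a)^-1.
Proof.
have [->|a0] := eqVneq a 0; first by rewrite !invr0 abs0 invr0.
by apply: (mulfI (abs_neq0 a0)); rewrite -absM !divff ?abs1 ?abs_neq0.
Qed.

Lemma absD_le a b e : abs a <= e -> abs b <= e -> abs (a + b) <= e.
Proof. by move=> ae be; rewrite (le_trans (absD a b))// ge_max ae. Qed.

Lemma absB_le a b e : abs a <= e -> abs b <= e -> abs (a - b) <= e.
Proof. by move=> ae be; apply: absD_le; rewrite ?absN. Qed.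

Lemma abs_dist a b c e : abs (a - b) <= e -> abs (b - c) <= e ->
  abs (a - c) <= e.
Proof. by move=> ? ?; rewrite -(subrKA b); apply: absD_le. Qed.

Lemma abs_sum_le (I : Type) (s : seq I) (P : pred I) (F : I -> K) e : 0 <= e ->
  (forall i, P i -> abs (F i) <= e) -> abs (\sum_(i <- s | P i) F i) <= e.
Proof.
move=> e0 Fe; apply: (big_ind (fun z => abs z <= e)) => //.
  by rewrite abs0.
by move=> *; apply: absD_le.
Qed.

Lemma absM_le1 a b e : abs a <= 1 -> abs b <= e -> abs (a * b) <= e.
Proof.
by move=> a1 be; rewrite absM (le_trans (ler_piMl _ a1)).
Qed.

Lemma abs_nat_le1 n : abs n%:R <= 1.
Proof.
by elim: n => [|n IH]; rewrite ?abs0// -addn1 natrD; apply: absD_le; rewrite ?abs1.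
Qed.

Lemma abs_int_le1 (m : int) : abs m%:~R <= 1.
Proof. by case: m => n; rewrite ?NegzE ?mulrNz ?absN abs_nat_le1. Qed.

Lemma abs_1D a : abs a < 1 -> abs (1 + a) = 1.
Proof.
move=> a1; apply/eqP; rewrite eq_le absD_le ?abs1// ?(ltW a1)//= leNgt.
apply/negP => b1.
have := absD (1 + a) (- a); rewrite addrK abs1 absN leNgt => /negP; apply.
by rewrite gt_max b1 a1.
Qed.

(** * Convergence and limits for [abs] *)

Lemma cvgKP u l : cvgK abs u l <->
  forall e, 0 < e -> exists N, forall n, (N <= n)%N -> abs (u n - l) < e.
Proof.
rewrite /cvgK; split=> [/cvgr0Pnorm_lt ul e e0|ul].
  have [N _ NP] := ul _ e0; exists N => n Nn.
  exact: le_lt_trans (ler_norm _) (NP n Nn).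
apply/cvgr0Pnorm_lt => e e0; have [N NP] := ul _ e0.
by exists N => // n Nn; rewrite /= ger0_norm//; apply: NP.
Qed.

Lemma cvgK_unique u l l' : cvgK abs u l -> cvgK abs u l' -> l = l'.
Proof.
move=> /cvgKP ul /cvgKP ul'; apply: contrapT => /eqP; rewrite -subr_eq0 => ll'.
have [N NP] := ul _ (abs_gt0 ll'); have [N' NP'] := ul' _ (abs_gt0 ll').
have n1 := NP (maxn N N') (leq_maxl _ _); have n2 := NP' (maxn N N') (leq_maxr _ _).
have := absD (l - u (maxn N N')) (u (maxn N N') - l').
by rewrite subrKA leNgt gt_max absB n1 n2.
Qed.

Lemma limKE u l : cvgK abs u l -> limK abs u = l.
Proof.
move=> ul; apply: (@cvgK_unique u) => //.
by apply: (@xgetPex _ 0 (fun l => cvgK abs u l)); exists l.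
Qed.

Lemma cvgKD u v l l' : cvgK abs u l -> cvgK abs v l' ->
  cvgK abs (fun n => u n + v n) (l + l').
Proof.
move=> /cvgKP ul /cvgKP vl; apply/cvgKP => e e0.
have [N NP] := ul _ e0; have [N' NP'] := vl _ e0.
exists (maxn N N') => n; rewrite geq_max => /andP[Nn N'n].
rewrite opprD addrACA (le_lt_trans (absD _ _))// gt_max.
by rewrite NP ?NP'.
Qed.

Lemma cvgKZ c u l : cvgK abs u l -> cvgK abs (fun n => c * u n) (c * l).
Proof.
move=> /cvgKP ul; apply/cvgKP => e e0.
have [->|c0] := eqVneq c 0.
  by exists 0%N => n _; rewrite !mul0r subrr abs0.
have [N NP] := ul _ (divr_gt0 e0 (abs_gt0 c0)); exists N => n Nn.
by rewrite -mulrBr absM mulrC -ltr_pdivlMr ?abs_gt0// NP.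
Qed.

Lemma cvgK_geo C rho u l : 0 <= rho < 1 ->
  (forall n, abs (u n - l) <= C * rho ^+ n) -> cvgK abs u l.
Proof.
move=> rho01 ul; apply/cvgKP => e e0.
have [N NP] := expr_lt_eventually C rho01 e0.
by exists N => n Nn; rewrite (le_lt_trans (ul n))// NP.
Qed.

(** Passage to the limit in estimates: a truncation error that decays geometrically may be added to
    the bound and then dropped. *)
Lemma abs_le_geo C rho e a : 0 <= rho < 1 -> 0 <= e ->
  (forall n, abs a <= Num.max e (C * rho ^+ n)) -> abs a <= e.
Proof.
by move=> rho01 e0 /(le_max_expr rho01)[//|a0]; apply: le_trans a0 e0.
Qed.

Lemma eq0_geo C rho a : 0 <= rho < 1 ->
  (forall n, abs a <= C * rho ^+ n) -> a = 0.
Proof.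
move=> rho01 aP; apply/abs_eq0/eqP; rewrite eq_le abs_ge0 andbT.
by apply: (abs_le_geo (C := C) rho01 (lexx _)) => n; rewrite le_max aP orbT.
Qed.

(** By the ultrametric inequality all increments after index [n] together move [u] by at most
    [rho^n], so no factor [1/(1-rho)] appears. *)
Lemma limK_geo rho u : 0 <= rho < 1 ->
  (forall n, abs (u n.+1 - u n) <= rho ^+ n) ->
  forall n, abs (u n - limK abs u) <= rho ^+ n.
Proof.
move=> rho01 uP; have /andP[rho0 rho1] := rho01.
have tail n k : abs (u (n + k)%N - u n) <= rho ^+ n.
  elim: k => [|k IH]; first by rewrite addn0 subrr abs0 exprn_ge0.
  apply: abs_dist IH; rewrite addnS (le_trans (uP _))//.
  by rewrite exprD ler_piMr ?exprn_ge0 ?exprn_ile1 ?(ltW rho1).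
have tail2 N m n : (N <= m)%N -> (N <= n)%N -> abs (u m - u n) <= rho ^+ N.
  move=> /subnKC <- /subnKC <-; apply: (@abs_dist _ (u N)) => //.
  by rewrite absB.
have [l ul] : exists l, cvgK abs u l.
  apply: abs_complete => e e0.
  have [N /(_ N (leqnn _)) NP] := expr_lt_eventually 1 rho01 e0.
  by exists N => m n Nm Nn; rewrite (le_lt_trans (tail2 _ _ _ Nm Nn))// -(mul1r (_ ^+ _)).
(* If [u n] were farther than [rho^n] from [l], a late term [u (n+N)] would be strictly closer than
   that distance to both [u n] and [l], against the ultrametric inequality. *)
rewrite (limKE ul) => n; rewrite leNgt; apply/negP => ltn.
have [N NP] := (cvgKP _ _).1 ul _ (le_lt_trans (exprn_ge0 n rho0) ltn).
have := absD (u n - u (n + N)%N) (u (n + N)%N - l); rewrite subrKA leNgt gt_max.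
by rewrite NP ?leq_addl// absB (le_lt_trans (tail _ _)).
Qed.

Lemma partial_sumS u n : partial_sum u n.+1 = partial_sum u n + u n.
Proof. exact: big_ord_recr. Qed.

Lemma sumKE C rho u S : 0 <= rho < 1 ->
  (forall n, abs (partial_sum u n - S) <= C * rho ^+ n) -> sumK abs u = S.
Proof. by move=> rho01 uS; apply: limKE; apply: cvgK_geo uS. Qed.

(** * Series dominated by a geometric sequence *)

Section Series.
Context (rho : R) (rho01 : 0 <= rho < 1).

Lemma rho_ge0 n : 0 <= rho ^+ n.
Proof. by case/andP: rho01 => ? ?; rewrite exprn_ge0. Qed.

Lemma rho_le1 n : rho ^+ n <= 1.
Proof. by case/andP: rho01 => ? /ltW ?; rewrite exprn_ile1. Qed.

Lemma rho_le m n : (m <= n)%N -> rho ^+ n <= rho ^+ m.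
Proof. by move=> /subnKC <-; rewrite exprD ler_piMr ?rho_ge0 ?rho_le1. Qed.

Lemma sumK_tail u : (forall n, abs (u n) <= rho ^+ n) ->
  forall n, abs (partial_sum u n - sumK abs u) <= rho ^+ n.
Proof. by move=> uP; apply: limK_geo => // n; rewrite partial_sumS addrC addKr. Qed.

Lemma cvgK_sumK u : (forall n, abs (u n) <= rho ^+ n) ->
  cvgK abs (partial_sum u) (sumK abs u).
Proof.
by move=> /sumK_tail uP; apply: (cvgK_geo (C := 1) rho01) => n; rewrite mul1r.
Qed.

Lemma partial_sum_le1 u n : (forall n, abs (u n) <= rho ^+ n) ->
  abs (partial_sum u n) <= 1.
Proof. by move=> uP; apply: abs_sum_le => // i _; apply: le_trans (rho_le1 i). Qed.

Lemma sumK_dist u v e : 0 <= e ->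
  (forall n, abs (u n) <= rho ^+ n) -> (forall n, abs (v n) <= rho ^+ n) ->
  (forall n, abs (u n - v n) <= e) -> abs (sumK abs u - sumK abs v) <= e.
Proof.
move=> e0 uP vP uv; apply: (abs_le_geo (C := 1) rho01 e0) => n; rewrite mul1r.
have tail w : (forall n, abs (w n) <= rho ^+ n) ->
    abs (partial_sum w n - sumK abs w) <= Num.max e (rho ^+ n).
  by move=> wP; rewrite le_max sumK_tail ?orbT.
apply: (@abs_dist _ (partial_sum u n)); first by rewrite absB tail.
apply: (@abs_dist _ (partial_sum v n)); last by rewrite tail.
rewrite -sumrB le_max abs_sum_le//.
Qed.

Lemma sumK_const0 : sumK abs (fun=> 0) = 0.
Proof.
by apply: (sumKE (C := 0) rho01) => n; rewrite /partial_sum big1// subrr abs0 mul0r.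
Qed.

Lemma abs_sumK_le u e : 0 <= e -> (forall n, abs (u n) <= rho ^+ n) ->
  (forall n, abs (u n) <= e) -> abs (sumK abs u) <= e.
Proof.
move=> e0 uP ue; rewrite -(subr0 (sumK _ _)) -sumK_const0.
by apply: sumK_dist => // n; rewrite ?abs0 ?rho_ge0 ?subr0.
Qed.

(** Both double sums are within [rho^N] of the finite triangle [k <= n < N], where the order of
    summation is free. *)
Lemma sumK_swap (w : nat -> nat -> K) :
  (forall n k, abs (w n k) <= rho ^+ n) ->
  (forall n k, (n < k)%N -> w n k = 0) ->
  sumK abs (fun n => \sum_(k < n.+1) w n k)
  = sumK abs (fun k => sumK abs (w^~ k)).
Proof.
move=> wP w0; symmetry; apply: (sumKE (C := 1) rho01) => N; rewrite mul1r.
apply: (@abs_dist _ (\sum_(k < N) partial_sum (w^~ k) N)).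
  rewrite -sumrB; apply: abs_sum_le (rho_ge0 _) _ => k _.
  by rewrite absB; apply: sumK_tail.
rewrite /partial_sum exchange_big /=.
rewrite (eq_bigr (fun n : 'I_N => \sum_(k < n.+1) w n k)); last first.
  move=> n _; rewrite [RHS](big_ord_widen N (w n)) ?ltn_ord// [RHS]big_mkcond.
  by apply: eq_bigr => k _; rewrite ltnS; case: leqP => // /w0.
by apply: (@sumK_tail (fun n => \sum_(k < n.+1) w n k)) => n; apply: abs_sum_le (rho_ge0 _) _.
Qed.

(* The products of terms missing from the Cauchy product of two partial sums
   are coefficients of order >= N of a product of polynomials. *)
Lemma sumK_mul u v : (forall n, abs (u n) <= rho ^+ n) ->
  (forall n, abs (v n) <= rho ^+ n) ->
  sumK abs u * sumK abs v = sumK abs (fun n => \sum_(i < n.+1) u i * v (n - i)%N).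
Proof.
move=> uP vP; set w := fun n => _.
symmetry; apply: (sumKE (C := 1) rho01) => N; rewrite mul1r.
apply: (@abs_dist _ (partial_sum u N * partial_sum v N)); last first.
  apply: (@abs_dist _ (partial_sum u N * sumK abs v)).
    by rewrite -mulrBr absM_le1 ?partial_sum_le1 ?sumK_tail.
  rewrite -mulrBl mulrC absM_le1 ?sumK_tail//.
  by apply: abs_sumK_le => // n; apply: le_trans (rho_le1 n).
pose P := \poly_(i < N) u i; pose Q := \poly_(i < N) v i.
have trunc (a : nat -> K) : (forall n, abs (a n) <= rho ^+ n) ->
    forall n, abs (\poly_(i < N) a i)`_n <= rho ^+ n.
  by move=> aP n; rewrite coef_poly; case: ifP => _; rewrite ?abs0 ?rho_ge0.
have coefPQ n : abs (P * Q)`_n <= rho ^+ n.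
  rewrite coefM; apply: abs_sum_le (rho_ge0 _) _ => i _.
  have -> : rho ^+ n = rho ^+ i * rho ^+ (n - i) by rewrite -exprD subnKC ?leq_ord.
  by rewrite absM ler_pM ?trunc.
have horner1 (a : nat -> K) : (\poly_(i < N) a i).[1] = partial_sum a N.
  by rewrite horner_poly; apply: eq_bigr => i _; rewrite expr1n mulr1.
(* This generous bound has the shape [N + _] so that the evaluation at 1 splits at degree [N]. *)
have sPQ : (size (P * Q)%R <= N + (N + N))%N.
  rewrite (leq_trans (size_polyMleq _ _))// (leq_trans (leq_pred _))//.
  by rewrite (leq_trans (leq_add (size_poly _ _) (size_poly _ _)))// leq_addl.
rewrite -(horner1 u) -(horner1 v) -hornerM (horner_coef_wide _ sPQ) big_split_ord /=.
rewrite opprD addrA /partial_sum -sumrB absB_le//.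
  rewrite big1 ?abs0 ?rho_ge0// => n _; rewrite expr1n mulr1 coefM -sumrB big1//.
  move=> i _; have iN := leq_trans (ltn_ord i) (ltn_ord n).
  by rewrite !coef_poly iN (leq_ltn_trans (leq_subr _ _))// subrr.
apply: abs_sum_le (rho_ge0 _) _ => i _; rewrite expr1n mulr1.
by rewrite (le_trans (coefPQ _))// rho_le ?leq_addr.
Qed.

End Series.
Lemma cvgK_ext u v l l' : u =1 v -> l = l' -> cvgK abs u l -> cvgK abs v l'.
Proof. by move=> /funext -> ->. Qed.

Lemma eq_sumK u v : u =1 v -> sumK abs u = sumK abs v.
Proof. by move=> /funext ->. Qed.

Section GeometricSeries.
Context (rho : R) (rho01 : 0 <= rho < 1).

Lemma sumKZ c u : (forall n, abs (u n) <= rho ^+ n) ->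
  sumK abs (fun n => c * u n) = c * sumK abs u.
Proof.
move=> /(cvgK_sumK rho01)/(cvgKZ c) uc; apply: limKE.
by apply: cvgK_ext uc => // n; apply: mulr_sumr.
Qed.

Lemma sumK_shift u : (forall n, abs (u n) <= rho ^+ n) ->
  sumK abs (fun n => u n.+1) = sumK abs u - u 0%N.
Proof.
move=> uP; apply: (sumKE (C := 1) rho01) => n; rewrite mul1r.
have -> : partial_sum (fun n => u n.+1) n = partial_sum u n.+1 - u 0%N.
  by rewrite /partial_sum big_ord_recl addrC addrA addNr add0r.
rewrite opprB addrA subrK (le_trans (sumK_tail rho01 uP _))//.
exact: (rho_le rho01 (leqnSn n)).
Qed.

End GeometricSeries.

Lemma ffactr_le1 z n : abs z <= 1 -> abs (ffactr z n) <= 1.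
Proof.
move=> z1; elim: n => [|n IH]; first by rewrite /ffactr big_ord0 abs1.
by rewrite ffactrS absM_le1// absB_le// abs_nat_le1.
Qed.

(** Each new factor is handled by the product rule for differences, whose cofactors have absolute
    value at most 1. *)
Lemma ffactr_lip z w n : abs z <= 1 -> abs w <= 1 ->
  abs (ffactr z n - ffactr w n) <= abs (z - w).
Proof.
move=> z1 w1; elim: n => [|n IH].
  by rewrite /ffactr !big_ord0 subrr abs0 abs_ge0.
have -> : ffactr z n.+1 - ffactr w n.+1
    = (z - n%:R) * (ffactr z n - ffactr w n) + ffactr w n * (z - w).
  by rewrite !ffactrS; ring.
by apply: absD_le; apply: absM_le1; rewrite ?ffactr_le1// absB_le// abs_nat_le1.
Qed.

(** * The binomial series and q-numbers *)

Section Padic.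
Context (p : nat) (p_prime : prime p) (p_odd : odd p).
Context (abs_p : abs p%:R = p%:R^-1).
Local Notation r := (exp_radius R p).

(** * The p-adic size of integers and factorials *)

Lemma pV01 : 0 <= (p%:R^-1 : R) < 1.
Proof. by rewrite invr_ge0 ler0n invf_lt1 ?ltr0n ?ltr1n ?prime_gt0 ?prime_gt1. Qed.

Lemma abs_pX n : abs (p ^ n)%N%:R = p%:R^-1 ^+ n.
Proof. by rewrite natrX absX abs_p. Qed.

Lemma exp_radius_gt0 : 0 < r.
Proof. by rewrite powR_gt0// ltr0n prime_gt0. Qed.

Lemma exp_radiusX : r ^+ p.-1 = p%:R^-1.
Proof.
rewrite -powR_mulrn ?(ltW exp_radius_gt0)// -powRrM -subn1 natrB ?prime_gt0//.
by rewrite mulNr mulVf ?powR_inv1// subr_eq0 -[1]/(1%:R) eqr_nat gtn_eqF ?prime_gt1.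
Qed.

Lemma exp_radius01 : 0 <= r < 1.
Proof.
rewrite (ltW exp_radius_gt0) ltNge; apply/negP => r1.
have := exprn_ege1 p.-1 r1; rewrite exp_radiusX leNgt.
by case/andP: pV01 => _ ->.
Qed.

(** Here [r^(p-1) = 1/p] with [p - 1 >= 2] because [p] is odd. It places [p] and its higher powers
    inside the disk of radius [r]. *)
Lemma pV_lt_exp_radius : p%:R^-1 < r.
Proof.
have p2 : (2 < p)%N by rewrite odd_prime_gt2.
have /andP[_ r1] := exp_radius01.
by rewrite -exp_radiusX ltr_iXnr ?exp_radius_gt0//; lia.
Qed.

(** A Bezout relation [k m = l p + 1] shows [|k m| = 1], while [|k|] and [|m|] are at most 1. *)
Lemma abs_coprime m : coprime p m -> abs m%:R = 1.
Proof.
case: m => [|m]; first by rewrite /coprime gcdn0 => /eqP p1; move: p_prime; rewrite p1.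
rewrite coprime_sym /coprime => /eqP pm.
have [k l kl _] := egcdnP p (ltn0Sn m).
have : abs (k * m.+1)%N%:R = 1.
  rewrite kl pm addnC natrD natrM abs_1D// (le_lt_trans (absM_le1 _ (lexx _)))//.
    exact: abs_nat_le1.
  by rewrite abs_p; case/andP: pV01.
rewrite natrM absM => km; apply/eqP; rewrite eq_le abs_nat_le1 -km.
by rewrite ler_piMl ?abs_nat_le1.
Qed.

Lemma abs_natE n : (0 < n)%N -> abs n%:R = p%:R^-1 ^+ logn p n.
Proof.
move=> n0; have [m pm {1}->] := pfactor_coprime p_prime n0.
by rewrite natrM absM abs_coprime// mul1r abs_pX.
Qed.

Lemma natr_neq0 n : n.+1%:R != 0 :> K.
Proof.
apply/eqP => /abs_eq0; rewrite abs_natE// => /eqP.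
by rewrite expf_eq0 invr_eq0 pnatr_eq0 eqn0Ngt (prime_gt0 p_prime) andbF.
Qed.

(** Legendre's formula with its first term split off; the others form Legendre's formula for
    [n %/ p]. *)
Lemma logn_fact_div n : logn p n`! = (n %/ p + logn p (n %/ p)`!)%N.
Proof.
case: n => [|n]; first by rewrite div0n.
have np : (n.+1 %/ p <= n)%N by rewrite -ltnS ltn_Pdiv ?prime_gt1.
rewrite !logn_fact// big_ltn// expn1 big_add1; congr addn.
rewrite [RHS](big_nat_widen _ _ n.+1) ?ltnS//.
rewrite [LHS]big_nat [RHS]big_mkcond [RHS]big_nat; apply: eq_bigr => k /andP[k1 kn].
rewrite expnS divnMA ltnS; case: leqP => // lk.
by rewrite divn_small// (ltn_trans lk)// ltn_expl// prime_gt1.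
Qed.

(** With [m+1 = (n+1) %/ p], induction bounds the left side by
    [(p-1)(m+1) + m = p(m+1) - 1 <= n]. *)
Lemma logn_fact_le n : (p.-1 * logn p n.+1`! <= n)%N.
Proof.
elim/ltn_ind: n => n IH; rewrite logn_fact_div.
case E : (n.+1 %/ p)%N => [|m]; first by rewrite logn1 muln0.
have mn : (m < n)%N by rewrite -ltnS -E ltn_Pdiv ?prime_gt1.
have := leq_divM n.+1 p; rewrite E => mp.
have := IH m mn; have := prime_gt0 p_prime; nia.
Qed.

(** One power of [r] sharper than [abs_fact_ge], as required for the q-number series, where [(n+1)!]
    divides the coefficient of the [n]-th power. *)
Lemma abs_factS_ge n : r ^+ n <= abs n.+1`!%:R.
Proof.
rewrite abs_natE ?fact_gt0// -exp_radiusX -exprM.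
exact: (rho_le exp_radius01 (logn_fact_le n)).
Qed.

Lemma abs_fact_ge n : r ^+ n <= abs n`!%:R.
Proof.
case: n => [|n]; first by rewrite expr0 fact0 abs1.
by rewrite (le_trans _ (abs_factS_ge n))// (rho_le exp_radius01).
Qed.

(** * Logarithm and binomial series on the disk of radius [r] *)

Section Disk.
Context (t : K) (tr : abs t < r).

Lemma disk_ratio01 : 0 <= abs t / r < 1.
Proof.
have r0 := exp_radius_gt0.
by rewrite ltr_pdivrMr// mul1r tr andbT divr_ge0// ltW.
Qed.

Lemma abs_div_exp n a b : r ^+ n <= abs b -> abs a <= 1 ->
  abs (a / b * t ^+ n) <= (abs t / r) ^+ n.
Proof.
move=> rb a1; rewrite -mulrA absM_le1// mulrC absM absV absX expr_div_n.
by rewrite ler_wpM2l ?exprn_ge0// lef_pV2// posrE ?(lt_le_trans _ rb)//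
  exprn_gt0// exp_radius_gt0.
Qed.

(** The function [log(1+t)^k / k!], as [plogE] and [stirling_seriesE] confirm. *)
Definition stirling_series k := sumK abs (fun n => stirf K n k * t ^+ n).

Lemma stirf_term_le n k : abs (stirf K n k * t ^+ n) <= (abs t / r) ^+ n.
Proof. by rewrite abs_div_exp ?abs_fact_ge// abs_int_le1. Qed.

Lemma stirling_series0 : stirling_series 0 = 1.
Proof.
apply: (sumKE (C := 1) disk_ratio01) => -[|n].
  by rewrite /partial_sum big_ord0 sub0r absN abs1 mulr1.
rewrite /partial_sum big_ord_recl stirf_n0 mulr1 big1 ?addr0 ?subrr ?abs0.
  by rewrite mul1r (rho_ge0 disk_ratio01).
by move=> i _; rewrite stirf_n0 mul0r.
Qed.

Lemma stirling_series1M k :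
  stirling_series 1 * stirling_series k = k.+1%:R * stirling_series k.+1.
Proof.
rewrite (sumK_mul disk_ratio01); try by move=> n; apply: stirf_term_le.
rewrite -(sumKZ disk_ratio01); last by move=> n; apply: stirf_term_le.
apply: eq_sumK => n; rewrite mulrA -(stirf_conv natr_neq0) mulr_suml.
apply: eq_bigr => i _.
have -> : t ^+ n = t ^+ i * t ^+ (n - i) by rewrite -exprD subnKC ?leq_ord.
ring.
Qed.

Lemma stirling_seriesE k : stirling_series k = stirling_series 1 ^+ k / k`!%:R.
Proof.
elim: k => [|k IH]; first by rewrite stirling_series0 expr0 fact0 divr1.
apply: (mulfI (natr_neq0 k)); rewrite -stirling_series1M IH factS natrM exprS.
by field; rewrite factr_neq0 ?nat1r ?natr_neq0//; exact: natr_neq0.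
Qed.

Lemma plogE : plog abs (1 + t) = stirling_series 1.
Proof.
rewrite -[RHS]subr0 -(mul0r (t ^+ 0)) -[X in X * _](@stirf_gt K 0 1)//.
rewrite -(sumK_shift disk_ratio01); last by move=> n; apply: stirf_term_le.
apply: eq_sumK => n; rewrite addrAC subrr add0r (stirf_Sn1 natr_neq0); ring.
Qed.

Lemma ppow_binomial z : abs z <= 1 ->
  ppow abs (1 + t) z = sumK abs (fun n => ffactr z n / n`!%:R * t ^+ n).
Proof.
move=> z1; have zk k : abs (z ^+ k) <= 1 by rewrite absX exprn_ile1.
rewrite /ppow /pexp plogE.
(* The terms are bounded by [(|t|/r)^n] uniformly in [k] and vanish for [k > n], so [sumK_swap]
   applies; summing over [n] first leaves the exponential series. *)
transitivity (sumK abs (fun n => \sum_(k < n.+1) z ^+ k * (stirf K n k * t ^+ n))).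
  rewrite (sumK_swap disk_ratio01 (w := fun n k => z ^+ k * (stirf K n k * t ^+ n))).
  - apply: eq_sumK => k; rewrite (sumKZ disk_ratio01); last first.
      by move=> n; apply: stirf_term_le.
    by rewrite exprMn -mulrA -stirling_seriesE.
  - by move=> n k; rewrite absM_le1// stirf_term_le.
  - by move=> n k nk; rewrite stirf_gt// mul0r mulr0.
apply: eq_sumK => n; rewrite ffactr_stirling1 !mulr_suml; apply: eq_bigr => k _.
by rewrite /stirf; ring.
Qed.

Lemma binomial_term_le z n : abs z <= 1 ->
  abs (ffactr z n / n`!%:R * t ^+ n) <= (abs t / r) ^+ n.
Proof. by move=> z1; rewrite abs_div_exp ?abs_fact_ge ?ffactr_le1. Qed.

Lemma ppow_lip z w : abs z <= 1 -> abs w <= 1 ->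
  abs (ppow abs (1 + t) z - ppow abs (1 + t) w) <= abs (z - w).
Proof.
move=> z1 w1; rewrite !ppow_binomial//.
apply: (sumK_dist disk_ratio01) => // n; try exact: binomial_term_le.
have -> : ffactr z n / n`!%:R * t ^+ n - ffactr w n / n`!%:R * t ^+ n
    = 1 / n`!%:R * t ^+ n * (ffactr z n - ffactr w n) by ring.
apply: absM_le1 (ffactr_lip n z1 w1); apply: le_trans (rho_le1 disk_ratio01 n).
by rewrite abs_div_exp ?abs_fact_ge ?abs1.
Qed.

End Disk.

(** * q-numbers as a power series in [q - 1] *)

Section Qnum.
Context (q : K) (qr : abs (q - 1) < r).

(** The binomial series of [q^x - 1] divided termwise by [q - 1]. It also makes sense at [q = 1],
    where only the term [n = 0], equal to [x], survives. *)
Definition qnum_series x :=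
  sumK abs (fun n => ffactr x n.+1 / n.+1`!%:R * (q - 1) ^+ n).

Lemma qnum_term_le x n : abs x <= 1 ->
  abs (ffactr x n.+1 / n.+1`!%:R * (q - 1) ^+ n) <= (abs (q - 1) / r) ^+ n.
Proof. by move=> x1; rewrite abs_div_exp ?abs_factS_ge ?ffactr_le1. Qed.

Lemma qnumE x : abs x <= 1 -> qnum abs q x = qnum_series x.
Proof.
move=> x1; rewrite /qnum; case: eqVneq => [q1|q1].
  symmetry; apply: (sumKE (C := 1) (disk_ratio01 qr)) => -[|n].
    by rewrite /partial_sum big_ord0 sub0r absN mulr1.
  rewrite /partial_sum big_ord_recl q1 subrr mulr1 big1 ?addr0.
    rewrite /ffactr big_ord1 subr0 divr1 subrr abs0 mul1r.
    by rewrite mul0r exprn_ge0.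
  by move=> i _; rewrite lift0 expr0n mulr0.
have q10 : q - 1 != 0 by rewrite subr_eq0.
apply: (mulIf q10); rewrite divfK// mulrC.
rewrite -(sumKZ (disk_ratio01 qr)); last by move=> n; apply: qnum_term_le.
rewrite -{1}(subrKC 1 q) ppow_binomial//.
pose u n := ffactr x n / n`!%:R * (q - 1) ^+ n.
transitivity (sumK abs u - u 0%N).
  by rewrite /u /ffactr big_ord0 fact0 divr1 mulr1.
rewrite -(sumK_shift (disk_ratio01 qr) (u := u)); last first.
  by move=> n; apply: binomial_term_le.
by apply: eq_sumK => n; rewrite /u exprS; ring.
Qed.

Lemma qnum_le1 x : abs x <= 1 -> abs (qnum abs q x) <= 1.
Proof.
move=> x1; rewrite qnumE//; apply: (abs_sumK_le (disk_ratio01 qr)) => // n.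
  exact: qnum_term_le.
by rewrite (le_trans (qnum_term_le n x1))// (rho_le1 (disk_ratio01 qr)).
Qed.

Lemma qnum_lip x y : abs x <= 1 -> abs y <= 1 ->
  abs (qnum abs q x - qnum abs q y) <= abs (x - y).
Proof.
move=> x1 y1; rewrite !qnumE//.
apply: (sumK_dist (disk_ratio01 qr)) => // n; try exact: qnum_term_le.
have -> : ffactr x n.+1 / n.+1`!%:R * (q - 1) ^+ n
      - ffactr y n.+1 / n.+1`!%:R * (q - 1) ^+ n
    = 1 / n.+1`!%:R * (q - 1) ^+ n * (ffactr x n.+1 - ffactr y n.+1) by ring.
apply: absM_le1 (ffactr_lip n.+1 x1 y1).
apply: le_trans (rho_le1 (disk_ratio01 qr) n).
by rewrite abs_div_exp ?abs_factS_ge ?abs1.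
Qed.

End Qnum.

(** * The fermionic integral *)

Section FermionicIntegral.
Context (q : K) (q1 : abs (q - 1) < 1).

Definition fermionic_avg (f : K -> K) N : K :=
  (qnum_neg q (p ^ N)%N)^-1 * \sum_(y < p ^ N) f y%:R * (- q) ^+ y.

Definition nat_lip (f : K -> K) :=
  forall m k : nat, abs (f (m + k)%:R - f m%:R) <= abs k%:R.

Lemma abs_q : abs q = 1.
Proof. by rewrite -(subrKC 1 q) abs_1D. Qed.

Lemma abs_NqX n : abs ((- q) ^+ n) = 1.
Proof. by rewrite absX absN abs_q expr1n. Qed.

(** As [p] is odd, [|2| = 1], and [q^n - 1] is a multiple of [q - 1] by an element of absolute value
    at most 1; hence [1 + q^n] is 2 times a unit close to 1. *)
Lemma abs_1DqX n : abs (1 + q ^+ n) = 1.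
Proof.
have a2 : abs 2%:R = 1 by rewrite abs_coprime// coprimen2.
have n2 : 2%:R != 0 :> K := natr_neq0 1.
have -> : 1 + q ^+ n = 2%:R * (1 + 2%:R^-1 * (q ^+ n - 1)) by field.
rewrite absM a2 mul1r abs_1D// absM absV a2 invr1 mul1r subrX1 mulrC.
apply: le_lt_trans q1; apply: absM_le1 => //; apply: abs_sum_le => // i _.
by rewrite absX abs_q expr1n.
Qed.

Lemma qnum_negE N : qnum_neg q (p ^ N)%N = (1 + q ^+ (p ^ N)) / (1 + q).
Proof. by rewrite /qnum_neg exprNn -signr_odd oddX p_odd orbT mulN1r opprK. Qed.

Lemma abs_qnum_neg N : abs (qnum_neg q (p ^ N)%N) = 1.
Proof. by rewrite qnum_negE absM absV -[in 1 + q](expr1 q) !abs_1DqX invr1 mulr1. Qed.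

Lemma qnum_neg_neq0 N : qnum_neg q (p ^ N)%N != 0.
Proof.
by apply/eqP => /abs_eq0; rewrite abs_qnum_neg => /eqP; rewrite oner_eq0.
Qed.

Lemma qnum_negS N : qnum_neg q (p ^ N.+1)%N
  = (\sum_(i < p) (- q) ^+ (p ^ N * i)) * qnum_neg q (p ^ N)%N.
Proof.
under eq_bigr => i _ do rewrite exprM.
rewrite /qnum_neg mulrA; congr (_ / _); rewrite expnSr exprM.
by rewrite -[LHS]opprB subrX1 -mulNr opprB mulrC.
Qed.

(** Cut the range into [j] blocks of length [M]: block [i] is [(-q)^(M i)] times the first one, up
    to replacing [f (M i + y)] by [f y]. *)
Lemma sum_blocks (f : K -> K) M j e : 0 <= e ->
  (forall i y, abs (f (M * i + y)%:R - f y%:R) <= e) ->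
  abs (\sum_(y < M * j) f y%:R * (- q) ^+ y
       - (\sum_(i < j) (- q) ^+ (M * i)) * \sum_(y < M) f y%:R * (- q) ^+ y) <= e.
Proof.
move=> e0 fe; elim: j => [|j IH].
  by rewrite muln0 !big_ord0 mul0r subrr abs0.
rewrite mulnSr big_split_ord big_ord_recr /= mulrDl opprD addrACA absD_le//.
rewrite mulr_sumr -sumrB; apply: abs_sum_le => // y _.
have -> : f (M * j + y)%:R * (- q) ^+ (M * j + y)
    - (- q) ^+ (M * j) * (f y%:R * (- q) ^+ y)
  = (- q) ^+ (M * j + y) * (f (M * j + y)%:R - f y%:R) by rewrite exprD; ring.
by apply: absM_le1 (fe _ _); rewrite abs_NqX.
Qed.

Lemma fermionic_tail f : nat_lip f -> forall N,
  abs (fermionic_avg f N - fermionic_integral abs p q f) <= p%:R^-1 ^+ N.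
Proof.
move=> fL; apply: (limK_geo (u := fermionic_avg f) pV01) => N.
have e0 := rho_ge0 pV01 N.
have blocks := sum_blocks p (M := (p ^ N)%N) (f := f) e0.
set G := \sum_(i < p) _ in blocks.
have G0 : G != 0.
  by have := qnum_neg_neq0 N.+1; rewrite qnum_negS mulf_eq0 => /norP[].
(* Since [G] is the quotient of the normalizers at [N+1] and [N], the difference of consecutive
   averages is exactly the normalized block error. *)
have -> : fermionic_avg f N.+1 - fermionic_avg f N = (qnum_neg q (p ^ N.+1)%N)^-1 *
   (\sum_(y < p ^ N * p) f y%:R * (- q) ^+ y
       - G * \sum_(y < p ^ N) f y%:R * (- q) ^+ y).
  rewrite /fermionic_avg qnum_negS -/G expnSr; field.
  by rewrite qnum_neg_neq0.
apply: absM_le1; first by rewrite absV abs_qnum_neg invr1.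
apply: blocks => i y; rewrite addnC (le_trans (fL _ _))// -abs_pX natrM mulrC.
by apply: absM_le1; rewrite ?abs_nat_le1.
Qed.

Lemma fermionic_avg_shift f N :
  q * fermionic_avg (fun y => f (y + 1)) N + fermionic_avg f N
  = (qnum_neg q (p ^ N)%N)^-1 * (f 0 + f (p ^ N)%N%:R * q ^+ (p ^ N)).
Proof.
rewrite /fermionic_avg mulrCA -mulrDr; congr (_ * _).
(* Telescoping: [q (-q)^y = - (-q)^(y+1)]. The sign at the upper end then disappears because [p^N]
   is odd. *)
have -> M : q * (\sum_(y < M) f (y%:R + 1) * (- q) ^+ y)
    + \sum_(y < M) f y%:R * (- q) ^+ y = f 0 - f M%:R * (- q) ^+ M.
  elim: M => [|M IH]; first by rewrite !big_ord0 mulr1 mulr0 addr0 subrr.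
  rewrite !big_ord_recr /= mulrDr addrACA IH natr1 exprS; ring.
by rewrite exprNn -signr_odd oddX p_odd orbT mulN1r mulrN opprK.
Qed.

Lemma fermionic_integral_shift f : nat_lip f ->
  q * fermionic_integral abs p q (fun y => f (y + 1)) + fermionic_integral abs p q f
  = (1 + q) * f 0.
Proof.
move=> fL; have gL : nat_lip (fun y => f (y + 1)).
  by move=> m k; rewrite !natr1 -addSn; apply: fL.
apply/eqP; rewrite -subr_eq0; apply/eqP.
apply: (eq0_geo (C := 1) pV01) => N; rewrite mul1r.
have ftail := fermionic_tail fL N; have gtail := fermionic_tail gL N.
apply: (@abs_dist _ (q * fermionic_avg (fun y => f (y + 1)) N + fermionic_avg f N)).
  rewrite absB opprD addrACA -mulrBr.
  by apply: absD_le => //; apply: absM_le1; rewrite ?abs_q.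
have n1 : 1 + q != 0.
  by rewrite -(expr1 q); apply/eqP => /abs_eq0/eqP; rewrite abs_1DqX oner_eq0.
have n2 : 1 + q ^+ (p ^ N) != 0.
  by apply/eqP => /abs_eq0/eqP; rewrite abs_1DqX oner_eq0.
(* The normalizer is [(1 + q^(p^N))/(1+q)], so replacing [f(p^N)] by [f 0] would give exactly
   [(1+q) f 0]; the discrepancy is at most [p^-N] by the Lipschitz bound. *)
have -> : q * fermionic_avg (fun y => f (y + 1)) N + fermionic_avg f N - (1 + q) * f 0
    = (qnum_neg q (p ^ N)%N)^-1 * q ^+ (p ^ N) * (f (0 + p ^ N)%N%:R - f 0%:R).
  rewrite fermionic_avg_shift qnum_negE add0n; field.
  by rewrite n1.
apply: absM_le1; last by rewrite -abs_pX; apply: fL.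
by rewrite absM absV abs_qnum_neg invr1 mul1r absX abs_q expr1n.
Qed.

End FermionicIntegral.

(** Convergence at [t = p] bounds the terms [a n] by some [B]. If the coefficients below [m] vanish,
    evaluation at [t = p^(j+1)] yields [|a m| <= B p^-j] for every [j]. *)
Lemma egf_coef_eq0 (c : nat -> K) :
  (forall t, abs t < r -> cvgK abs (partial_sum (fun n => c n * (t ^+ n / n`!%:R))) 0) ->
  forall n, c n = 0.
Proof.
move=> c0; pose a n := c n * (p%:R ^+ n / n`!%:R).
have pr : abs p%:R < r by rewrite abs_p pV_lt_exp_radius.
have [B B0 aB] : exists2 B : R, 0 < B & forall n, abs (a n) <= B.
  have [N NP] := (cvgKP _ _).1 (c0 _ pr) 1 ltr01.
  have B0 : 0 <= \sum_(n < N) abs (a n) by apply: sumr_ge0.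
  exists (1 + \sum_(n < N) abs (a n)); first by rewrite ltr_pwDl.
  move=> n; have [nN|Nn] := ltnP n N.
    by rewrite (bigD1 (Ordinal nN)) //= addrCA lerDl addr_ge0// sumr_ge0.
  apply: (@le_trans _ _ 1); last by rewrite lerDl.
  have -> : a n = (partial_sum a n.+1 - 0) - (partial_sum a n - 0).
    by rewrite partial_sumS; ring.
  by apply: absB_le; apply: ltW; apply: NP => //; apply: leqW.
elim/ltn_ind => m IH.
suff am : a m = 0.
  apply/eqP; move/eqP: am; rewrite mulf_eq0 mulf_eq0 invr_eq0 expf_eq0.
  rewrite (negPf (factr_neq0 natr_neq0 m)).
  have := natr_neq0 p.-1; rewrite (prednK (prime_gt0 p_prime)) => /negPf ->.
  by rewrite andbF !orbF.
apply: (eq0_geo (C := B) pV01) => j.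
have pj : 0 < (p%:R^-1 : R) ^+ j by rewrite exprn_gt0// invr_gt0 ltr0n prime_gt0.
have tr : abs (p%:R ^+ j.+1) < r.
  rewrite absX abs_p (le_lt_trans _ pV_lt_exp_radius)// -[leRHS]expr1.
  exact: (rho_le pV01 (ltn0Sn j)).
pose b n := c n * ((p%:R ^+ j.+1) ^+ n / n`!%:R).
have bE n : b n = a n * (p%:R ^+ j) ^+ n by rewrite /b /a exprSr exprMn; ring.
have bj n : abs (b n) = abs (a n) * (p%:R^-1 ^+ j) ^+ n.
  by rewrite bE absM !absX abs_p.
have e0 : 0 < B * (p%:R^-1 ^+ j) ^+ m.+1 := mulr_gt0 B0 (exprn_gt0 _ pj).
have [N NP] := (cvgKP _ _).1 (c0 _ tr) _ e0.
have : abs (b m) <= B * (p%:R^-1 ^+ j) ^+ m.+1.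
  (* The partial sum consists of a vanishing head, [b m] and a tail [T] of terms at most
     [B p^(-j(m+1))]. *)
  have := NP (m.+1 + N)%N (leq_addl _ _); rewrite subr0 => /ltW.
  rewrite /partial_sum big_split_ord big_ord_recr /=.
  rewrite [X in X + _ + _]big1 ?add0r; last first.
    by move=> i _; rewrite (IH i (ltn_ord i)) mul0r.
  set T := \sum_(i < N) _ => bT; rewrite -(addrK T (b m)) absB_le//.
  apply: abs_sum_le (ltW e0) _ => i _; rewrite -/(b _) bj.
  rewrite ler_pM ?exprn_ge0 ?(ltW pj)//.
  exact: (ler_wiXn2l (ltW pj) (rho_le1 pV01 j) (leq_addr i m.+1)).
rewrite bj exprS mulrA ler_pM2r => //; exact: exprn_gt0.
Qed.

(** * Changhee polynomials *)

Section ChangheePolynomials.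
Context (q : K) (qr : abs (q - 1) < r).

Lemma subq1_lt1 : abs (q - 1) < 1.
Proof. by case/andP: exp_radius01 => _; apply: lt_trans. Qed.

Lemma abs_addn_le1 x n : abs x <= 1 -> abs (x + n%:R) <= 1.
Proof. by move=> x1; apply: absD_le; rewrite ?abs_nat_le1. Qed.

Lemma qnum_nat_lip x : abs x <= 1 -> nat_lip (fun y => qnum abs q (x + y)).
Proof.
move=> x1 m k; rewrite (le_trans (qnum_lip _ _ _)) ?abs_addn_le1//.
by rewrite natrD opprD addrACA subrr add0r addrC addKr.
Qed.

Lemma ffactr_qnum_lip x n : abs x <= 1 ->
  nat_lip (fun y => ffactr (qnum abs q (x + y)) n).
Proof.
move=> x1 m k; rewrite (le_trans _ (qnum_nat_lip x1 m k))//.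
by rewrite ffactr_lip ?qnum_le1 ?abs_addn_le1.
Qed.

Lemma ppow_qnum_lip x t : abs x <= 1 -> abs t < r ->
  nat_lip (fun y => ppow abs (1 + t) (qnum abs q (x + y))).
Proof.
move=> x1 tr m k; rewrite (le_trans _ (qnum_nat_lip x1 m k))//.
by rewrite ppow_lip ?qnum_le1 ?abs_addn_le1.
Qed.

(** The coefficients are the integrals of the falling factorials of [[x+y]_q]. Only finite sums are
    interchanged: the series is cut at [N] and the integrals are replaced by their [M]-th
    averages. *)
Lemma Changhee_egf_exists x : abs x <= 1 -> exists c, Changhee_egf abs p q x c.
Proof.
move=> x1; pose f n y := ffactr (qnum abs q (x + y)) n.
exists (fun n => fermionic_integral abs p q (f n)) => t tr.
pose F y := ppow abs (1 + t) (qnum abs q (x + y)); pose tau n := t ^+ n / n`!%:R.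
have tau1 n : abs (tau n) <= 1.
  rewrite /tau mulrC -[_^-1]mul1r.
  rewrite (le_trans (abs_div_exp t (abs_fact_ge n) _)) ?abs1//.
  exact: (rho_le1 (disk_ratio01 tr)).
apply: (cvgK_geo (C := 1) (disk_ratio01 tr)) => N; rewrite mul1r.
apply: (abs_le_geo (C := 1) pV01 (rho_ge0 (disk_ratio01 tr) N)) => M.
(* The bound [e] allows for both the truncation error [(|t|/r)^N] and the averaging error [p^-M];
   the latter vanishes as [M] grows. *)
rewrite mul1r; set e := Num.max _ _.
have rho_e : (abs t / r) ^+ N <= e by rewrite le_max lexx.
have p_e : p%:R^-1 ^+ M <= e by rewrite le_max lexx orbT.
have e0 : 0 <= e := le_trans (rho_ge0 pV01 M) p_e.
apply: (@abs_dist _ (\sum_(n < N) fermionic_avg q (f n) M * tau n)).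
  rewrite absB -sumrB; apply: abs_sum_le => // n _.
  rewrite -mulrBl mulrC; apply: absM_le1 => //.
  by rewrite (le_trans (fermionic_tail subq1_lt1 (ffactr_qnum_lip n x1) M)).
apply: (@abs_dist _ (fermionic_avg q F M)); last first.
  by rewrite (le_trans (fermionic_tail subq1_lt1 (ppow_qnum_lip x1 tr) M)).
have -> : \sum_(n < N) fermionic_avg q (f n) M * tau n
    = (qnum_neg q (p ^ M)%N)^-1 * \sum_(y < p ^ M)
       partial_sum (fun n => f n y%:R / n`!%:R * t ^+ n) N * (- q) ^+ y.
  under eq_bigr => n _ do rewrite -mulrA mulr_suml.
  rewrite -mulr_sumr exchange_big; congr (_ * _); apply: eq_bigr => y _.
  by rewrite mulr_suml; apply: eq_bigr => n _; rewrite /tau; ring.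
rewrite -mulrBr -sumrB; apply: absM_le1.
  by rewrite absV (abs_qnum_neg subq1_lt1) invr1.
apply: abs_sum_le => // y _; rewrite -mulrBl mulrC.
apply: absM_le1; first by rewrite (abs_NqX subq1_lt1).
have z1 : abs (qnum abs q (x + y%:R)) <= 1 by rewrite qnum_le1 ?abs_addn_le1.
rewrite /F (ppow_binomial tr z1) (le_trans _ rho_e)//.
by apply: (sumK_tail (disk_ratio01 tr)) => n; apply: binomial_term_le.
Qed.

Lemma ChangheeP x : abs x <= 1 ->
  Changhee_egf abs p q x (fun n => Changhee abs p q n x).
Proof. by move=> /Changhee_egf_exists; apply: xgetPex. Qed.

(** The combination of the two Changhee series and the binomial series of [(1+t)^[x]_q] converges to
    0 on the disk by the shift formula of the integral, so its coefficients vanish. *)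
Lemma Changhee_shift x n : abs x <= 1 ->
  q * Changhee abs p q n (x + 1) + Changhee abs p q n x
  = (1 + q) * ffactr (qnum abs q x) n.
Proof.
move=> x1; have x11 : abs (x + 1) <= 1 := abs_addn_le1 1 x1.
apply/eqP; rewrite -subr_eq0; apply/eqP; move: n; apply: egf_coef_eq0 => t tr.
have z1 := qnum_le1 qr x1.
have E : cvgK abs (partial_sum (fun n => ffactr (qnum abs q x) n / n`!%:R * t ^+ n))
    (ppow abs (1 + t) (qnum abs q x)).
  rewrite (ppow_binomial tr z1); apply: (cvgK_sumK (disk_ratio01 tr)) => n.
  exact: binomial_term_le.
pose f y := ppow abs (1 + t) (qnum abs q (x + y)).
pose g y := ppow abs (1 + t) (qnum abs q (x + 1 + y)).
have shift : q * fermionic_integral abs p q g + fermionic_integral abs p q f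
    = (1 + q) * ppow abs (1 + t) (qnum abs q x).
  have -> : g = (fun y => f (y + 1)).
    by apply/funext => y; rewrite /g /f [y + 1]addrC addrA.
  have fL : nat_lip f := ppow_qnum_lip x1 tr.
  by rewrite (fermionic_integral_shift subq1_lt1 fL) /f addr0.
have := cvgKD (cvgKD (cvgKZ q (ChangheeP x11 tr)) (ChangheeP x1 tr))
  (cvgKZ (- (1 + q)) E).
apply: cvgK_ext => [N|].
  rewrite /partial_sum !mulr_sumr -!big_split.
  apply: eq_bigr => n _ /=; move: (Changhee _ _ _ _ _) (Changhee _ _ _ _ _) => a b.
  by move: (ffactr _ _) => c; ring.
by rewrite mulNr; apply/eqP; rewrite subr_eq0; apply/eqP; exact: shift.
Qed.

End ChangheePolynomials.
End Padic.
End Ultrametric.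

Theorem theorem4 (p : nat) (p_prime : prime p) (p_odd : odd p)
    (R : realType) (Cp : closedFieldType) (abs : Cp -> R)
    (hCp : is_Cp p abs)
    (q : Cp) (hq : abs (1 - q) < exp_radius R p)
    (x : Cp) (hx : padicZ abs x) (n : nat) :
  q * Changhee abs p q n (x + 1) + Changhee abs p q n x
  = (1 + q) * \sum_(l < n.+1) (stirling1 n l)%:~R * qnum abs q x ^+ l.
Proof.
case: hCp => abs_ge0 abs_eq0 absM absD abs_p abs_complete _.
rewrite -ffactr_stirling1.
rewrite (absB abs_ge0 abs_eq0 absM) in hq.
case: hx => _ x1.
exact: (Changhee_shift abs_ge0 abs_eq0 absM absD abs_complete p_prime p_odd abs_p hq n x1).
Qed.
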